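(* Let $$\Omega:=\Bigl\{(\alpha,\beta,\gamma):\ \beta\in\mathbb R,\ \gamma\ge0,\ \alpha=(\alpha_i)_{i\in\mathbb N}\text{ with }\alpha_i\in\mathbb R,\ \alpha_{i+1}\ll\alpha_i\text{ for all }i,\ \sum_{i=1}^\infty\alpha_i^2<\infty\Bigr\}.$$ For any element $\omega=(\alpha,\beta,\gamma)\in\Omega$ there exists a Vershik-Kerov sequence $(\lambda(n))$ with VK parameters $\omega$.
   Context: For $x,y\in\mathbb R$: $x\ll y$ iff either $|x|<|y|$, or $|x|=|y|$ and $x\le y$. Power sums: $p_m(x)=\sum_i x_i^m$. A sequence $(\lambda(n))_n$ with $\lambda(n)\in\mathbb R^n$ having entries decreasing w.r.t. $\ll$ (each entry is $\ll$ the preceding one) is a Vershik-Kerov (VK) sequence if the following (finite) limits exist: $\alpha_i:=\lim_{n}\lambda(n)_i/n$ for all $i\in\mathbb N$, $\beta:=\lim_n p_1(\lambda(n))/n$, $\delta:=\lim_n p_2(\lambda(n))/n^2$. In this case $\sum_i\alpha_i^2\le\delta$, one puts $\gamma:=\delta-\sum_i\alpha_i^2\ge0$, and $(\alpha,\beta,\gamma)$ with $\alpha=(\alpha_i)_{i\in\mathbb N}$ are the VK parameters of the sequence. *)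

(* Defs.v *)
From HB Require Import structures.
From mathcomp Require Import all_boot all_order all_algebra.
From mathcomp Require Import all_classical all_reals all_analysis.

Set Implicit Arguments.
Unset Strict Implicit.
Unset Printing Implicit Defensive.

Import Order.TTheory GRing.Theory Num.Theory.
Import numFieldNormedType.Exports.

Local Open Scope classical_set_scope.
Local Open Scope ring_scope.

Definition abs_le (R : realType) (x y : R) : Prop :=
  `|x| < `|y| \/ (`|x| = `|y| /\ x <= y).

Notation "x ≪ y" := (abs_le x y) (at level 70, no associativity) : ring_scope.

Definition powersum (R : realType) (m n : nat) (x : 'rV[R]_n) : R :=
  \sum_(i < n) x 0 i ^+ m.

Definition decreasing (R : realType) (n : nat) (x : 'rV[R]_n) : Prop :=
  forall i j : 'I_n, j = i.+1 :> nat -> x 0 j ≪ x 0 i.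

(* Entries are numbered from 0.  The i-th entry of a vector of R^n only exists
   for i < n; the value 0 elsewhere concerns finitely many n for each i, hence
   does not affect limits in n. *)
Definition entry (R : realType) (n : nat) (x : 'rV[R]_n) (i : nat) : R :=
  oapp (x 0) 0 (insub i : option 'I_n).

Section VershikKerov.
Variables (R : realType) (lambda : forall n : nat, 'rV[R]_n).

Definition scaled_entry (i : nat) : R^nat :=
  fun n => entry (lambda n) i / n%:R.

Definition scaled_p1 : R^nat :=
  fun n => powersum 1 (lambda n) / n%:R.

Definition scaled_p2 : R^nat :=
  fun n => powersum 2 (lambda n) / n%:R ^+ 2.

Definition VK_sequence : Prop :=
  [/\ forall n, decreasing (lambda n),
      forall i, cvgn (scaled_entry i),
      cvgn scaled_p1 &
      cvgn scaled_p2].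

Definition VK_alpha : R^nat := fun i => limn (scaled_entry i).

Definition VK_beta : R := limn scaled_p1.

Definition VK_delta : R := limn scaled_p2.

Definition VK_gamma : R :=
  VK_delta - limn (series (fun i => VK_alpha i ^+ 2)).

(* [limn] is total: these values are meaningful under [VK_sequence]. *)
Definition VK_parameters : R^nat * R * R := (VK_alpha, VK_beta, VK_gamma).

End VershikKerov.

Definition Omega (R : realType) : set (R^nat * R * R) :=
  [set w | let: (alpha, beta, gamma) := w in
    [/\ 0 <= gamma,
        forall i, alpha i.+1 ≪ alpha i &
        cvgn (series (fun i => alpha i ^+ 2))]].

(* Main.v *)
Require Import Defs.
From mathcomp Require Import all_boot all_order all_algebra.
From mathcomp Require Import all_classical all_reals all_analysis.
From mathcomp Require Import zify ring lra.

Import Order.TTheory GRing.Theory Num.Theory.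
Import numFieldNormedType.Exports.

Local Open Scope classical_set_scope.
Local Open Scope ring_scope.

(** Work with the normalized vectors [lambda(n) / n], padded by zeros.  A finite
piece of [alpha] already has approximately the right large entries and the
right sum of squares [\sum_i alpha_i ^+ 2]; what is missing is the correct sum
[beta] and the extra mass [gamma] of squares, and both must be supplied by
entries that are uniformly small, so as not to change the limits of the
individual entries.  This is possible with two values only: [2h] small entries,
half of them [a + b] and half of them [a - b], contribute [2ha] to the sum and
[2h (a ^+ 2 + b ^+ 2)] to the sum of squares.  With [s] the missing part of the
sum, [a = s / 2h] makes the sum exact, and [b ^+ 2 = gamma / 2h] makes the sum
of squares off by [s ^+ 2 / 2h] only, which is negligible if [h] is large.

The vector must also be sorted.  At stage [m], [alpha] is cut at the threshold
[t = D / m], where [D] is such that [t] bounds the small entries: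
the entries of [alpha] that exceed [t] in absolute value come first, then the
small ones, then zeros.  Among the first [m] entries of [alpha], those discarded
by the threshold have squares adding up to at most [m t ^+ 2 = D ^+ 2 / m].  With
[h = 2 m ^ 4] all errors are [O(1 / m)]; this is [finite_approximation].

Stage [m] uses a support of size [N m = m + 4 m ^ 4], hence fits into [R^n] as
soon as [N m <= n].  Taking for [lambda(n)] the stage [m(n)], with [m(n)]
tending to infinity slowly enough, gives the sequence
([VK_sequence_of_finite_support]). *)

(** * The order by absolute value *)

Lemma abs_le0 (R : realType) (x : R) : 0 ≪ x.
Proof.
rewrite /abs_le normr0; have [->|x0] := eqVneq x 0.
  by right; rewrite normr0.
by left; rewrite normr_gt0.
Qed.

Lemma abs_le_scale (R : realType) (c x y : R) : 0 <= c -> x ≪ y -> c * x ≪ c * y.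
Proof.
rewrite le_eqVlt => /predU1P[<- _|c0]; first by rewrite !mul0r; exact: abs_le0.
rewrite /abs_le !normrM ltr_pM2l ?normr_gt0 ?gt_eqF// ler_pM2l//.
by case=> [|[-> xy]]; [left | right].
Qed.

Lemma abs_le_nonincreasing (R : realType) (alpha : R^nat) :
  (forall i, alpha i.+1 ≪ alpha i) ->
  forall i j, (i <= j)%N -> `|alpha j| <= `|alpha i|.
Proof.
move=> alphaS; apply/(nonincreasing_seqP (fun i => `|alpha i|)) => i /=.
by case: (alphaS i) => [/ltW|[-> _]].
Qed.

(** The two values used for the small entries are [a + b] and [a - b], in the
order imposed by [≪], which depends on the signs of [a] and [b].  Only the
symmetric functions of the pair matter afterwards. *)
Lemma abs_le_pair (R : realType) (a b : R) : exists u v : R,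
  [/\ v ≪ u, `|u| <= `|a| + `|b|, u + v = 2 * a &
      u ^+ 2 + v ^+ 2 = 2 * (a ^+ 2 + b ^+ 2)].
Proof.
have abs_le_total (x y : R) : x ≪ y \/ y ≪ x.
  rewrite /abs_le; case: (ltgtP `|x| `|y|); [by left; left|by right; left|].
  by move=> ->; have [|/ltW] := leP x y; [left; right|right; right].
have [le|le] := abs_le_total (a - b) (a + b).
- exists (a + b), (a - b); split => //; [exact: ler_normD|ring|ring].
- exists (a - b), (a + b); split => //; [exact: ler_normB|ring|ring].
Qed.

(** * Vectors with two plateaus *)

Definition staircase {R : realType} (alpha : R^nat) (k h : nat) (u v : R) : R^nat :=
  fun i => if (i < k)%N then alpha i else
           if (i < k + h)%N then u else
           if (i < k + h + h)%N then v else 0.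

Lemma staircase_decreasing (R : realType) (alpha : R^nat) k h (u v : R) :
  (forall i, alpha i.+1 ≪ alpha i) ->
  (forall i, (i < k)%N -> `|u| < `|alpha i|) -> v ≪ u ->
  forall i, staircase alpha k h u v i.+1 ≪ staircase alpha k h u v i.
Proof.
move=> alphaS ualpha vu i; rewrite /staircase.
have refl (x : R) : x ≪ x by right.
case: (ltnP i.+1 k) => [ik|ki]; first by rewrite (ltnW ik).
case: (ltnP i k) => [ik|ki'].
  have -> : k = i.+1 by lia.
  case: ltnP => h0; first by left; apply: ualpha.
  by rewrite ifF; [exact: abs_le0|lia].
case: (ltnP i.+1 (k + h)) => [ikh|khi]; first by rewrite (ltnW ikh).
case: (ltnP i.+1 (k + h + h)) => [ikh|khi']; last exact: abs_le0.
by rewrite (ltnW ikh); case: ltnP.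
Qed.

Lemma staircase_eq0 (R : realType) (alpha : R^nat) k h (u v : R) i :
  (k + h + h <= i)%N -> staircase alpha k h u v i = 0.
Proof. by move=> khi; rewrite /staircase !ifF//; lia. Qed.

Lemma sum_staircase (R : realType) (f : R -> R) (alpha : R^nat) k h (u v : R) N :
  f 0 = 0 -> (k + h + h <= N)%N ->
  \sum_(0 <= i < N) f (staircase alpha k h u v i) =
  \sum_(0 <= i < k) f (alpha i) + (f u + f v) *+ h.
Proof.
move=> f0 khN.
rewrite (@big_cat_nat _ _ _ (k + h + h)%N)//= [X in _ + X]big1_seq ?addr0; last first.
  by move=> i /=; rewrite mem_index_iota => /andP[khi _]; rewrite staircase_eq0.
rewrite (@big_cat_nat _ _ _ (k + h)%N)//= ?leq_addr//.
rewrite (@big_cat_nat _ _ _ k)//= ?leq_addr// mulrnDl addrA.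
congr (_ + _ + _).
- by apply: eq_big_nat => i /andP[_ ik]; rewrite /staircase ik.
- rewrite (eq_big_nat _ _ (F2 := fun=> f u)) => [|i /andP[ki ikh]].
    by rewrite sumr_const_nat; congr (_ *+ _); lia.
  by rewrite /staircase ikh ifF//; lia.
- rewrite (eq_big_nat _ _ (F2 := fun=> f v)) => [|i /andP[ki ikh]].
    by rewrite sumr_const_nat; congr (_ *+ _); lia.
  by rewrite /staircase ikh !ifF//; lia.
Qed.

(** Since [|alpha|] is nonincreasing, the entries above a threshold form an initial
segment; its length, capped by [m], exists even if no entry is below [t]. *)
Lemma threshold_index (R : realType) (alpha : R^nat) (t : R) (m : nat) :
  (forall i j, (i <= j)%N -> `|alpha j| <= `|alpha i|) ->
  exists2 k, (k <= m)%N &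
    (forall i, (i < k)%N -> t < `|alpha i|) /\
    (forall i, (k <= i < m)%N -> `|alpha i| <= t).
Proof.
move=> alpha_dec; elim: m => [|m [k km [gtt let_]]].
  by exists 0%N => //; split=> i; lia.
have [kEm|kNm] := eqVneq k m; last first.
  have {}km : (k < m)%N by lia.
  exists k => //; first lia.
  split=> // i /andP[ki _]; apply: le_trans (let_ k _); first exact: alpha_dec.
  by rewrite leqnn.
have [mt|tm] := leP `|alpha m| t.
  exists m => //; split=> [i im|i /andP[mi iSm]]; first by apply: gtt; rewrite kEm.
  by have -> : i = m by lia.
exists m.+1 => //; split=> [i im|i]; last lia.
by apply: lt_le_trans tm _; apply: alpha_dec.
Qed.

(** * Approximation by finitely supported sequences *)

(** The sum is exact, whereas the large entries and the sum of squares are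
correct up to [O(1 / m)], the latter being compared with a partial sum of the
series of squares of [alpha]. *)
Lemma finite_approximation (R : realType) (alpha : R^nat) (beta gamma : R) :
  0 <= gamma -> (forall i, alpha i.+1 ≪ alpha i) ->
  exists K : R, forall m : nat, exists y : R^nat,
    [/\ forall i, y i.+1 ≪ y i,
        forall i, (m + 4 * m ^ 4 <= i)%N -> y i = 0,
        forall i, (i < m)%N -> `|y i - alpha i| <= K / m%:R,
        (0 < m)%N -> \sum_(0 <= i < m + 4 * m ^ 4) y i = beta &
        (0 < m)%N ->
          `|\sum_(0 <= i < m + 4 * m ^ 4) y i ^+ 2 -
            (\sum_(0 <= i < m) alpha i ^+ 2 + gamma)| <= K / m%:R].
Proof.
move=> gamma0 alphaS.
have alpha_dec := abs_le_nonincreasing _ _ alphaS.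
(* [C * m] bounds the missing sum [s]; the two parts [C] and [g] of [D] control
   the mean and the deviation of the small entries. *)
set C := `|beta| + `|alpha 0%N|; set g := Num.sqrt gamma; set D := C + g.
have g0 : 0 <= g by exact: sqrtr_ge0.
have C0 : 0 <= C by rewrite addr_ge0.
have D0 : 0 <= D by rewrite addr_ge0.
exists (2 * D + 2 * D ^+ 2) => m; have [->|m0] := posnP m.
  by exists (fun=> 0); split => // i; exact: abs_le0.
set M : R := m%:R; set X := M^-1.
have M1 : 1 <= M by rewrite ler1n.
have M0 : M != 0 by rewrite gt_eqF// (lt_le_trans ltr01).
have MX : M * X = 1 by rewrite mulfV.
have X0 : 0 <= X by rewrite invr_ge0 (le_trans ler01).
have X1 : X <= 1 by rewrite invf_le1// (lt_le_trans ltr01).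
set t := D * X.
have t0 : 0 <= t by rewrite mulr_ge0.
have [k km [alphagt alphale]] := threshold_index _ _ t m alpha_dec.
set s := beta - \sum_(0 <= i < k) alpha i.
have sCM : `|s| <= C * M.
  rewrite (le_trans (ler_normB _ _))// /C mulrDl lerD//; first by rewrite ler_peMr.
  apply: le_trans (ler_norm_sum _ _ _) _.
  apply: (@le_trans _ _ (\sum_(0 <= i < k) `|alpha 0%N|)).
    by apply: ler_sum => i _; exact: alpha_dec.
  by rewrite sumr_const_nat subn0 -[leLHS]mulr_natr ler_wpM2l// ler_nat.
(* With [2 h = 4 m ^ 4 = (2 m ^ 2) ^ 2], the mean [s / 2h] and the deviation
   [sqrt gamma / sqrt 2h] become the two arguments below. *)
have [u [v [vu uab uva uv2]]] := abs_le_pair _ (s * (X ^+ 4 / 4)) (g * (X ^+ 2 / 2)).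
have X2 : X ^+ 2 <= X by rewrite expr2 ler_piMr.
have X20 : 0 <= X ^+ 2 by rewrite exprn_ge0.
have X40 : 0 <= X ^+ 4 by rewrite exprn_ge0.
have ut : `|u| <= t.
  apply: le_trans uab _; rewrite (_ : t = C * X + g * X); last exact: mulrDl.
  apply: lerD; rewrite normrM.
    rewrite (@ger0_norm _ (_ / _)) ?divr_ge0//.
    apply: (@le_trans _ _ (C * M * (X ^+ 4 / 4))).
      by apply: ler_wpM2r => //; rewrite divr_ge0.
    rewrite (_ : _ * _ = C * ((M * X) * X * (X ^+ 2 / 4))); last by ring.
    by rewrite MX mul1r ler_wpM2l// ler_piMr//; lra.
  rewrite (ger0_norm g0) ger0_norm ?divr_ge0//.
  by apply: ler_wpM2l => //; lra.
have vt : `|v| <= t.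
  by apply: le_trans ut; case: vu => [/ltW|[-> _]].
set h := (2 * m ^ 4)%N.
have khN : (k + h + h <= m + 4 * m ^ 4)%N by rewrite -addnA -mulnDl leq_add.
have MX4 : M ^+ 4 * X ^+ 4 = 1 by rewrite -exprMn MX expr1n.
have hR : h%:R = 2 * M ^+ 4 by rewrite /h natrM natrX.
exists (staircase alpha k h u v); split.
- apply: staircase_decreasing => // i ik.
  exact: le_lt_trans ut (alphagt _ ik).
- by move=> i Ni; apply: staircase_eq0; exact: leq_trans khN Ni.
- move=> i im; apply: le_trans (_ : 2 * t <= _); last first.
    rewrite /t mulrA; apply: ler_wpM2r => //; have := sqr_ge0 D; lra.
  case: (ltnP i k) => [ik|ki].
    by rewrite /staircase ik subrr normr0 mulr_ge0.
  rewrite mulr_natl mulr2n (le_trans (ler_normB _ _))// lerD//; last first.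
    by apply: alphale; rewrite ki.
  by rewrite /staircase ltnNge ki/=; do 2 case: ifP => // _; rewrite normr0.
- move=> _; rewrite (@sum_staircase _ id)// uva -[_ *+ h]mulr_natr hR.
  have -> : 2 * (s * (X ^+ 4 / 4)) * (2 * M ^+ 4) = s * (M ^+ 4 * X ^+ 4) by field.
  by rewrite MX4 mulr1 /s addrC subrK.
- move=> _; rewrite (@sum_staircase _ (fun x => x ^+ 2)) ?expr0n// uv2 -[_ *+ h]mulr_natr hR.
  have -> : 2 * ((s * (X ^+ 4 / 4)) ^+ 2 + (g * (X ^+ 2 / 2)) ^+ 2) * (2 * M ^+ 4) =
      (M ^+ 4 * X ^+ 4) * (s ^+ 2 * X ^+ 4 / 4 + g ^+ 2) by field.
  rewrite MX4 mul1r sqr_sqrtr//.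
  (* The error is the difference of two nonnegative terms: [s ^+ 2 / 2h] and the
     squares of the entries of [alpha] between [k] and [m], all below [t]. *)
  rewrite (@big_cat_nat _ _ _ k 0 m)//=.
  set A := \sum_(0 <= i < k) _; set B := \sum_(k <= i < m) _.
  have B0 : 0 <= B by apply: sumr_ge0 => i _; exact: sqr_ge0.
  have Bt : B <= D ^+ 2 * X.
    apply: (@le_trans _ _ (\sum_(k <= i < m) t ^+ 2)).
      apply: ler_sum_nat => i kim.
      by rewrite -real_normK ?num_real// ler_pXn2r ?nnegrE// alphale.
    rewrite sumr_const_nat.
    apply: (@le_trans _ _ (t ^+ 2 * M)).
      rewrite -[leLHS]mulr_natr; apply: ler_wpM2l; first exact: sqr_ge0.
      by rewrite ler_nat leq_subr.
    rewrite (_ : _ * _ = D ^+ 2 * X * (M * X)); last by rewrite /t; ring.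
    by rewrite MX mulr1.
  have s0 : 0 <= s ^+ 2 * X ^+ 4 / 4.
    by rewrite divr_ge0// mulr_ge0// sqr_ge0.
  have sX : s ^+ 2 * X ^+ 4 / 4 <= D ^+ 2 * X.
    have s2 : s ^+ 2 <= (D * M) ^+ 2.
      have sDM : `|s| <= D * M.
        by apply: le_trans sCM _; rewrite ler_wpM2r ?(le_trans ler01)// lerDl.
      have DM0 : 0 <= D * M by apply: le_trans sDM.
      by rewrite -real_normK ?num_real// ler_pXn2r ?nnegrE.
    apply: (@le_trans _ _ ((D * M) ^+ 2 * X ^+ 4)).
      have := ler_wpM2r X40 s2.
      have : 0 <= s ^+ 2 * X ^+ 4 by rewrite mulr_ge0// sqr_ge0.
      lra.
    rewrite (_ : _ * _ = D ^+ 2 * X ^+ 2 * (M * X) ^+ 2); last by ring.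
    by rewrite MX expr1n mulr1 ler_wpM2l// sqr_ge0.
  have DX : 0 <= D * X by exact: mulr_ge0.
  rewrite -/X ler_norml; apply/andP; split; lra.
Qed.

(** * From finitely supported sequences to vectors of growing size *)

(** Taking the largest [m <= n] with [N m <= n] works for any [N]: the bound
[m <= n] keeps the maximum finite, and [N 0 = 0] makes it attained. *)
Lemma slow_index (N : nat -> nat) : N 0%N = 0%N ->
  exists2 m : nat -> nat, (forall n, (N (m n) <= n)%N) & m @ \oo --> \oo.
Proof.
move=> N0; exists (fun n => \max_(m < n.+1 | (N m <= n)%N) m)%N => [n|].
  elim/big_ind: _ => [|m1 m2 N1 N2|//]; first by rewrite N0.
  by rewrite /maxn; case: ifP.
apply/cvgnyPge => A; near=> n.
have An : (A < n.+1)%N by rewrite ltnS; near: n; exact: nbhs_infty_ge.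
apply: (@leq_bigmax_cond _ _ _ (Ordinal An)) => /=.
by near: n; exact: nbhs_infty_ge.
Unshelve. all: by end_near. Qed.

Lemma cvg_natV_dist (R : realType) (u v : R^nat) (l K : R) :
  (\forall n \near \oo, `|u n - v n| <= K / n%:R) ->
  v @ \oo --> l -> u @ \oo --> l.
Proof.
move=> uv vl; apply: cvg_sub0 vl; apply: norm_cvg0.
have KV : K / n%:R @[n --> \oo] --> (0 : R).
  rewrite -[X in _ --> X](mulr0 K); apply: cvgMr => /=.
  apply/gtr0_cvgV0; last exact: cvgr_idn.
  by near=> n; rewrite ltr0n; near: n; exact: nbhs_infty_gt.
apply: squeeze_cvgr (cvg_cst 0) KV.
by near=> n; rewrite normr_ge0/=; near: n.
Unshelve. all: by end_near. Qed.

(** The vectors are [n] times the truncations of [y (m n)], with [m] a slow index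
for [N]: the truncation to size [n] then loses only zeros, so the normalized
quantities are those of [y] along [m]. *)
Lemma VK_sequence_of_finite_support (R : realType) (N : nat -> nat)
    (y : nat -> R^nat) (alpha : R^nat) (beta delta : R) :
  N 0%N = 0%N ->
  (forall m i, y m i.+1 ≪ y m i) ->
  (forall m i, (N m <= i)%N -> y m i = 0) ->
  (forall i, y m i @[m --> \oo] --> alpha i) ->
  \sum_(0 <= i < N m) y m i @[m --> \oo] --> beta ->
  \sum_(0 <= i < N m) y m i ^+ 2 @[m --> \oo] --> delta ->
  exists lambda : forall n : nat, 'rV[R]_n,
    [/\ VK_sequence lambda, VK_alpha lambda = alpha,
        VK_beta lambda = beta & VK_delta lambda = delta].
Proof.
move=> N0 yS yN y_alpha y_beta y_delta.
have [m mN moo] := slow_index _ N0.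
pose lambda n : 'rV[R]_n := \row_(i < n) (n%:R * y (m n) i).
have powersumE e n : (0 < e)%N -> (0 < n)%N ->
    powersum e (lambda n) / n%:R ^+ e = \sum_(0 <= i < N (m n)) y (m n) i ^+ e.
  move=> e0 n0; rewrite /powersum.
  under eq_bigr do rewrite mxE exprMn.
  rewrite -big_distrr/= mulrAC mulfV ?mul1r; last first.
    by rewrite expf_neq0// pnatr_eq0 -lt0n.
  rewrite -(big_mkord xpredT (fun i => y (m n) i ^+ e)).
  rewrite (@big_cat_nat _ _ _ (N (m n)))//=.
  rewrite [X in _ + X]big1_seq ?addr0// => i /=.
  by rewrite mem_index_iota => /andP[Ni _]; rewrite yN// expr0n eqn0Ngt e0.
have alphaP i : scaled_entry lambda i @ \oo --> alpha i.
  have := cvg_comp _ _ moo (y_alpha i); apply: cvg_trans.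
  apply: near_eq_cvg; near=> n.
  have ni : (i < n)%N by near: n; exact: nbhs_infty_gt.
  rewrite /scaled_entry /entry insubT/= mxE mulrAC mulfV ?mul1r//.
  by rewrite pnatr_eq0 -lt0n (leq_ltn_trans _ ni).
have betaP : scaled_p1 lambda @ \oo --> beta.
  have := cvg_comp _ _ moo y_beta; apply: cvg_trans.
  apply: near_eq_cvg; near=> n.
  have n0 : (0 < n)%N by near: n; exact: nbhs_infty_gt.
  by rewrite /scaled_p1/= -[n%:R]expr1 powersumE.
have deltaP : scaled_p2 lambda @ \oo --> delta.
  have := cvg_comp _ _ moo y_delta; apply: cvg_trans.
  apply: near_eq_cvg; near=> n.
  have n0 : (0 < n)%N by near: n; exact: nbhs_infty_gt.
  by rewrite /scaled_p2/= powersumE.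
exists lambda; split.
- split.
  + by move=> n i j ji; rewrite !mxE ji; apply: abs_le_scale.
  + by move=> i; apply/cvg_ex; exists (alpha i).
  + by apply/cvg_ex; exists beta.
  + by apply/cvg_ex; exists delta.
- by apply/funext => i; exact: cvg_lim.
- exact: cvg_lim.
- exact: cvg_lim.
Unshelve. all: by end_near. Qed.

(** * Existence of Vershik-Kerov sequences *)

Theorem proposition3p16 (R : realType) (omega : R^nat * R * R) :
  Omega omega ->
  exists lambda : forall n : nat, 'rV[R]_n,
    VK_sequence lambda /\ VK_parameters lambda = omega.
Proof.
case: omega => -[alpha beta] gamma [gamma0 alphaS alpha2].
have [K /choice[y yP]] := finite_approximation _ _ beta _ gamma0 alphaS.
set S := limn (series (fun i => alpha i ^+ 2)).
have [|||i|||lambda [VK alphaE betaE deltaE]] :=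
  @VK_sequence_of_finite_support R (fun m => m + 4 * m ^ 4)%N y alpha beta (S + gamma).
- by [].
- by move=> m; have [] := yP m.
- by move=> m; have [] := yP m.
- apply: (@cvg_natV_dist _ _ (fun=> alpha i) _ K); last exact: cvg_cst.
  near=> m; have [_ _ + _ _] := yP m; apply.
  by near: m; exact: nbhs_infty_gt.
- apply: cvg_near_cst; near=> m; have [_ _ _ + _] := yP m; apply.
  by near: m; exact: nbhs_infty_gt.
- apply: (@cvg_natV_dist _ _ (fun m => series (fun i => alpha i ^+ 2) m + gamma) _ K).
    near=> m; have [_ _ _ _ +] := yP m; apply.
    by near: m; exact: nbhs_infty_gt.
  by apply: cvgD; [exact: alpha2|exact: cvg_cst].
exists lambda; split => //.
by rewrite /VK_parameters /VK_gamma alphaE betaE deltaE -/S addrC addKr.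
Unshelve. all: by end_near. Qed.
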